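(* If $T\in M_n(\mathbb{C})$ has distinct eigenvalues and is unitarily equivalent to a matrix of the form $QDQ^{-1}$, where $D$ is diagonal and $Q$ belongs to $\mathrm{SU}(n-1,1)$, then $T$ is UECSM.
   Context: Two matrices $A,B\in M_n(\mathbb{C})$ are unitarily equivalent if $A = UBU^*$ for some unitary matrix $U$. A matrix $T \in M_n(\mathbb{C})$ is called UECSM if it is unitarily equivalent to a complex symmetric matrix, i.e. a matrix $S \in M_n(\mathbb{C})$ with $S = S^t$ (transpose without conjugation). $\mathrm{SU}(k,n-k)$ is the group of $n\times n$ complex matrices having determinant $1$ and preserving the Hermitian form $\langle v,w\rangle_k=\sum_{j=1}^k v_j\overline{w_j}-\sum_{j=k+1}^n v_j\overline{w_j}$; the latter means $Q^*AQ=A$ where $A=I_k\oplus(-I_{n-k})$. Here $k=n-1$. *)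

(* Defs.v *)
From mathcomp Require Import all_boot all_order all_algebra.
From mathcomp Require Import reals complex.
Set Implicit Arguments.
Unset Strict Implicit.
Unset Printing Implicit Defensive.
Import GRing.Theory Num.Theory.
Local Open Scope ring_scope.
Local Open Scope sesquilinear_scope.

Definition unitarily_equivalent (C : numClosedFieldType) (n : nat)
    (A B : 'M[C]_n) : Prop :=
  exists2 U : 'M[C]_n, U \is unitarymx & A = U *m B *m U^t*.

(* S^T is the plain transpose, without conjugation. *)
Definition UECSM (C : numClosedFieldType) (n : nat) (T : 'M[C]_n) : Prop :=
  exists2 S : 'M[C]_n, S = S^T & unitarily_equivalent T S.

(* I_k (+) -I_(n-k), meaningful for k <= n; written entrywise so that the
   size stays n rather than k + (n - k). *)
Definition signature_mx (C : numClosedFieldType) (n k : nat) : 'M[C]_n :=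
  diag_mx (\row_(j < n) (if (j < k)%N then 1 else -1)).

(* Q \in SU(k, n-k). *)
Definition in_SU (C : numClosedFieldType) (n k : nat) (Q : 'M[C]_n) : Prop :=
  \det Q = 1 /\ Q^t* *m signature_mx C n k *m Q = signature_mx C n k.

(* n pairwise distinct eigenvalues. The library's [eigenvalue] is in terms of
   row (left) eigenvectors, which gives the usual spectrum. *)
Definition distinct_eigenvalues (C : numClosedFieldType) (n : nat)
    (T : 'M[C]_n) : Prop :=
  exists2 s : n.-tuple C, uniq s & all (eigenvalue T) s.

(* Main.v *)
Require Import Defs.
From mathcomp Require Import all_boot all_order all_algebra.
From mathcomp Require Import reals complex.
Local Open Scope ring_scope.

(** Let [A] be the signature matrix and [v] the last row of [Q]. Since
    [Q^* A Q = A], the Gram matrix of the columns of [Q] is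
    [Q^* Q = A + 2 v^* v]. Choose a diagonal unitary [E] with [v E] the
    entrywise conjugate of [v]; then [E] intertwines [Q^* Q] with its
    entrywise conjugate, which makes the symmetric matrix [W = Q A E Q^T]
    unitary. As [D] commutes with [A E], the matrix [M = Q D Q^-1] satisfies
    [M W = W M^T]. Finally a symmetric unitary matrix factors as [W = X X^T]
    with [X] unitary, and then [X^* M X] is symmetric. *)

Import GRing.Theory Num.Theory Num.Def.
Local Open Scope sesquilinear_scope.

Section UnitaryEquivalence.
Variable C : numClosedFieldType.

Lemma trmxC_mul m n p (A : 'M[C]_(m, n)) (B : 'M[C]_(n, p)) :
  (A *m B)^t* = B^t* *m A^t*.
Proof. by rewrite trmx_mul map_mxM. Qed.

Lemma map_mx_conjCK m n (A : 'M[C]_(m, n)) :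
  map_mx conjC (map_mx conjC A) = A.
Proof. by apply/matrixP => i j; rewrite !mxE conjCK. Qed.

Lemma unitarymx_mulCt {n} {U : 'M[C]_n} :
  U \is unitarymx -> U^t* *m U = 1%:M.
Proof. by move=> /unitarymxP/mulmx1C. Qed.

Lemma unitarymx_normal {n} {U : 'M[C]_n} :
  U \is unitarymx -> U \is normalmx.
Proof.
by move=> Uu; apply/normalmxP; rewrite (unitarymx_mulCt Uu); apply/unitarymxP.
Qed.

Lemma diag_unitarymxP {n} {d : 'rV[C]_n} :
  reflect (forall i, `|d 0 i| = 1) (diag_mx d \is unitarymx).
Proof.
have -> : (diag_mx d \is unitarymx)
    = (diag_mx (\row_i (`|d 0 i| ^+ 2)) == 1%:M).
  rewrite qualifE /= tr_diag_mx map_diag_mx mulmx_diag.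
  by congr (diag_mx _ == _); apply/rowP => i; rewrite !mxE normCK.
apply: (iffP eqP) => [/matrixP d1 i | d1].
  have := d1 i i; rewrite !mxE eqxx !mulr1n => /eqP.
  by rewrite sqrp_eq1 ?normr_ge0 // => /eqP.
by apply/matrixP => i j; rewrite !mxE d1 expr1n.
Qed.

(** Entrywise, commutation says [(d_i - d_j) K_ij = 0]: wherever [K_ij] is nonzero, [d_i = d_j] and
    hence [g d_i = g d_j]. *)
Lemma diag_mx_comm_map n (g : C -> C) (d : 'rV[C]_n) (K : 'M[C]_n) :
  diag_mx d *m K = K *m diag_mx d ->
  diag_mx (map_mx g d) *m K = K *m diag_mx (map_mx g d).
Proof.
rewrite !mul_diag_mx !mul_mx_diag => /matrixP dK; apply/matrixP => i j.
have := dK i j; rewrite !mxE => dKij.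
have [->|Kn0] := eqVneq (K i j) 0; first by rewrite mul0r mulr0.
have -> : d 0 i = d 0 j by apply: (mulIf Kn0); rewrite dKij mulrC.
by rewrite mulrC.
Qed.

(* The square root of [W] taken in a spectral basis is again symmetric: with
   [K] the Gram matrix of that basis for the bilinear form, symmetry of [W]
   says that [K] commutes with the diagonal of eigenvalues, hence with the
   diagonal of their square roots. *)
Lemma symmetric_unitary_factor n (W : 'M[C]_n) :
  W = W^T -> W \is unitarymx ->
  exists2 X : 'M[C]_n, X \is unitarymx & W = X *m X^T.
Proof.
move=> Wsym Wu.
have Pu := spectral_unitarymx W.
have := orthomx_spectralP (unitarymx_normal Wu).
move: (spectralmx W) Pu (spectral_diag W) => P Pu d.
rewrite (invmx_unitary Pu) => defW.
have PP := unitarymxP Pu; have PtP := unitarymx_mulCt Pu.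
have PPc : (P^t*)^T *m P^T = 1%:M by rewrite -trmx_mul PP trmx1.
have PcP : P^T *m (P^t*)^T = 1%:M by rewrite -trmx_mul PtP trmx1.
have defd : diag_mx d = P *m W *m P^t*.
  by rewrite defW !mulmxA PP mul1mx -mulmxA PP mulmx1.
have d1 : forall i, `|d 0 i| = 1.
  apply/diag_unitarymxP; rewrite defd.
  by rewrite !mul_unitarymx // trmxC_unitary.
pose s := map_mx sqrtC d; pose S := diag_mx s.
have SS : S *m S = diag_mx d.
  rewrite mulmx_diag; congr diag_mx; apply/rowP => i.
  by rewrite !mxE -expr2 sqrtCK.
have Su : S \is unitarymx.
  apply/diag_unitarymxP => i; apply/eqP.
  by rewrite -(@sqrp_eq1 _ `|_|) ?normr_ge0 // -normrX mxE sqrtCK d1.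
pose K := P *m P^T.
have dK : diag_mx d *m K = K *m diag_mx d.
  have /(congr1 (fun Z => P *m Z *m P^T)) := Wsym.
  rewrite {1 2}defW !trmx_mul tr_diag_mx /K !mulmxA PP mul1mx => ->.
  by rewrite -!mulmxA PPc mulmx1.
have SK : S *m K = K *m S by exact: diag_mx_comm_map.
exists (P^t* *m S *m P).
  by rewrite !mul_unitarymx // trmxC_unitary.
rewrite !trmx_mul tr_diag_mx -/S {1}defW -SS.
rewrite -!mulmxA; congr (_ *m (S *m _)).
have -> : P *m (P^T *m (S *m (P^t*)^T)) = K *m S *m (P^t*)^T.
  by rewrite /K !mulmxA.
by rewrite -SK /K -!mulmxA PcP mulmx1.
Qed.

Lemma UECSM_unitarily_equivalent n (T M : 'M[C]_n) :
  unitarily_equivalent T M -> UECSM M -> UECSM T.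
Proof.
move=> [U Uu ->] [S Ssym [V Vu ->]]; exists S => //.
by exists (U *m V); rewrite ?mul_unitarymx // trmxC_mul !mulmxA.
Qed.

Lemma UECSM_symmetric_intertwiner n (M W : 'M[C]_n) :
  W = W^T -> W \is unitarymx -> M *m W = W *m M^T -> UECSM M.
Proof.
move=> Wsym Wu MW; have [X Xu defW] := symmetric_unitary_factor _ _ Wsym Wu.
have XX := unitarymxP Xu; have XtX := unitarymx_mulCt Xu.
have XXc : X^T *m (X^t*)^T = 1%:M by rewrite -trmx_mul XtX trmx1.
exists (X^t* *m M *m X); last first.
  by exists X => //; rewrite !mulmxA XX mul1mx -mulmxA XX mulmx1.
have /(congr1 (fun Z => X^t* *m Z *m (X^t*)^T)) := MW.
rewrite defW -!mulmxA XXc mulmx1 !trmx_mul => ->.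
by rewrite !mulmxA XtX mul1mx.
Qed.

(** With [D = diag_mx d], [F = diag_mx f] and [W = Q F Q^T], both [M W] and [W M^T] collapse to
    [Q D F Q^T], because diagonal matrices commute. *)
Lemma UECSM_similar_diag n (Q : 'M[C]_n) (d f : 'rV[C]_n) :
  Q \in unitmx -> Q *m diag_mx f *m Q^T \is unitarymx ->
  UECSM (Q *m diag_mx d *m invmx Q).
Proof.
move=> Qunit Wu; apply: (UECSM_symmetric_intertwiner _ _ _ _ Wu).
  by rewrite !trmx_mul tr_diag_mx trmxK mulmxA.
rewrite !trmx_mul tr_diag_mx trmx_inv -!mulmxA mulKmx //.
rewrite (mulmxA Q^T) mulmxV ?unitmx_tr // mul1mx.
by rewrite !(mulmxA (diag_mx _)) diag_mxC.
Qed.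

Lemma conj_phase (z : C) : exists2 e : C, `|e| = 1 & z * e = z^*.
Proof.
(* The quotient [z^* / z] has modulus 1 only for nonzero [z]; at 0 any phase will do. *)
have [->|z0] := eqVneq z 0; first by exists 1; rewrite ?normr1 // mul0r conjC0.
exists (z^* / z); last by rewrite mulrC divfK.
by rewrite normf_div norm_conjC divff // normr_eq0.
Qed.

Lemma conj_phase_row n (v : 'rV[C]_n) :
  exists2 e : 'rV[C]_n, diag_mx e \is unitarymx & v *m diag_mx e = v ^ conjC.
Proof.
have /fin_all_exists2 [e e1 ve] := fun i => conj_phase (v 0 i).
exists (\row_i e i); first by apply/diag_unitarymxP => i; rewrite mxE.
by apply/rowP => i; rewrite mul_mx_diag !mxE ve.
Qed.

Lemma signature_mx_sqr n k :
  signature_mx C n k *m signature_mx C n k = 1%:M.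
Proof.
rewrite mulmx_diag -diag_const_mx; congr diag_mx.
by apply/rowP => i; rewrite !mxE; case: ifP; rewrite ?mulrNN mulr1.
Qed.

Lemma signature_mx_conj n k :
  (signature_mx C n k) ^ conjC = signature_mx C n k.
Proof.
rewrite map_diag_mx; congr diag_mx.
by apply/rowP => i; rewrite !mxE; case: ifP; rewrite ?rmorphN rmorph1.
Qed.

Lemma signature_mx_last n :
  1%:M = signature_mx C n.+1 n + 2 *: delta_mx ord_max ord_max.
Proof.
apply/matrixP => i j; rewrite !mxE.
case: (eqVneq i j) => [<-|/negPf ij]; last first.
  rewrite !mulr0n add0r.
  case: (eqVneq i ord_max) => [ei|]; last by rewrite mulr0.
  by rewrite -ei eq_sym ij mulr0.
rewrite andbb ltn_neqAle -ltnS ltn_ord andbT -(inj_eq val_inj) /=.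
case: eqVneq => _; rewrite /= !mulr1n ?mulr0 ?addr0 //.
by rewrite mulr1 addrC -addrA subrr addr0.
Qed.

Lemma signature_preserving_gram n (Q : 'M[C]_n.+1) :
  let A := signature_mx C n.+1 n in let v := row ord_max Q in
  Q^t* *m A *m Q = A -> Q^t* *m Q = A + 2 *: (v^t* *m v).
Proof.
move=> A v QAQ.
(* Split the identity inserted between [Q^t*] and [Q]: its signature part gives [A] by hypothesis,
   its rank-one part selects the last row of [Q]. *)
rewrite -[Q^t* in LHS]mulmx1 (signature_mx_last n) -/A.
rewrite mulmxDr mulmxDl QAQ -scalemxAr -scalemxAl /v rowE trmxC_mul.
have -> : (delta_mx 0 ord_max : 'rV[C]_n.+1)^t* = delta_mx ord_max 0.
  by rewrite trmx_delta map_delta_mx.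
by rewrite !mulmxA -(mulmxA (Q^t*)) mul_delta_mx.
Qed.

Lemma UECSM_SU_similar n (Q D : 'M[C]_n.+1) :
  is_diag_mx D -> in_SU n Q -> UECSM (Q *m D *m invmx Q).
Proof.
move=> /diag_mxP [d ->] [detQ QAQ].
have gramQ := signature_preserving_gram _ _ QAQ.
have [e Eu ve] := conj_phase_row _ (row ord_max Q).
set A := signature_mx C n.+1 n in QAQ gramQ.
set v := row ord_max Q in gramQ ve.
set E := diag_mx e in Eu ve.
have AA : A *m A = 1%:M := signature_mx_sqr _ _.
have Ac : A ^ conjC = A := signature_mx_conj _ _.
have At : A^T = A by exact: tr_diag_mx.
have AE : A *m E = E *m A by exact: diag_mxC.
have Et : E^T = E by exact: tr_diag_mx.
have QAQt : Q *m A *m Q^t* = A.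
  (* A one-sided inverse of a square matrix is two-sided, so [Q^t*] preserves the form as well. *)
  have /mulmx1C : (A *m Q^t*) *m (A *m Q) = 1%:M.
    by rewrite -AA -{4}QAQ !mulmxA.
  move=> /(congr1 (mulmx A)); rewrite mulmx1 => AAQ.
  by rewrite -[RHS]AAQ !mulmxA AA mul1mx.
(* [E] commutes with [A], and [v E = conj v] gives [E v^T = v^*] and [conj v E^* = v]. *)
have gramE : E *m map_mx conjC (Q^t* *m Q) *m E^t* = Q^t* *m Q.
  rewrite gramQ map_mxD map_mxZ map_mxM Ac rmorph_nat.
  rewrite mulmxDr mulmxDl -AE -mulmxA (unitarymxP Eu) mulmx1; congr (_ + _).
  rewrite -scalemxAr -scalemxAl; congr (_ *: _).
  have -> : map_mx conjC (v^t*) = v^T by rewrite map_mx_conjCK.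
  rewrite mulmxA -{1}Et -trmx_mul ve -mulmxA Et -map_mxM ve.
  by rewrite map_trmx map_mx_conjCK.
have [f defF] : exists f, diag_mx f = A *m E by rewrite mulmx_diag; eexists.
apply: (UECSM_similar_diag _ _ _ f); first by rewrite unitmxE detQ unitr1.
rewrite defF; apply/unitarymxP.
have -> : (Q *m (A *m E) *m Q^T)^t* = (Q^T)^t* *m E^t* *m A *m Q^t*.
  by rewrite !trmxC_mul At Ac !mulmxA.
have QtQc : Q^T *m (Q^T)^t* = map_mx conjC (Q^t* *m Q).
  by rewrite map_mxM trmxK map_mx_conjCK.
(* Regroup [W W^*] around the conjugated Gram matrix, which [gramE] turns into [Q^t* Q]; what
   remains is the square of [Q A Q^t* = A]. *)
transitivity (Q *m A *m (E *m (Q^T *m (Q^T)^t*) *m E^t*) *m A *m Q^t*).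
  by rewrite !mulmxA.
rewrite QtQc gramE.
transitivity ((Q *m A *m Q^t*) *m (Q *m A *m Q^t*)); first by rewrite !mulmxA.
by rewrite QAQt AA.
Qed.

End UnitaryEquivalence.

Theorem theorem5 (R : realType) (n : nat) (T D Q : 'M[R[i]]_n) :
  (0 < n)%N ->
  distinct_eigenvalues T ->
  is_diag_mx D ->
  in_SU n.-1 Q ->
  unitarily_equivalent T (Q *m D *m invmx Q) ->
  UECSM T.
Proof.
(* In size [n.+1] the index [n.+1.-1] reduces to [n], so the single minus sign sits at [ord_max]. *)
case: n T D Q => [//|n] T D Q _ _ Ddiag QSU TM.
apply: UECSM_unitarily_equivalent TM _.
exact: UECSM_SU_similar Ddiag QSU.
Qed.
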